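(* Let $\mathbb{K}$ be a field, $n,d\ge1$ and $k\ge0$ integers. Then $$\frac{d}{dz}HS(S_{n,d,k};z)=n\,HS(S_{n+1,d,k-1};z).$$
   Context: For $m\ge1$ and an integer $l$, the Veronese module is $S_{m,d,l}=\bigoplus_{i\ge0}S_{l+id}$, where $S=\mathbb{K}[x_1,\dots,x_m]=\bigoplus_{j\ge 0}S_j$ is the polynomial ring in $m$ variables with the standard grading, and $S_j=0$ for $j<0$. The grading on $S_{m,d,l}$ is the one inherited from $S$ (elements of $S_{l+id}$ have degree $l+id$), and $HS(M;z)=\sum_{j}\dim_{\mathbb{K}}(M_j)\,z^j$ is the Hilbert series, with $\frac{d}{dz}$ the formal derivative of power series. *)

(* Defs.v *)
From Stdlib Require Import ClassicalEpsilon.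
From mathcomp Require Import all_boot all_order all_algebra.
From mathcomp.multinomials Require Export mpoly.

Set Implicit Arguments.
Unset Strict Implicit.
Unset Printing Implicit Defensive.

Import GRing.Theory.
Local Open Scope ring_scope.

(* Possibly infinite-dimensional ambient spaces such as {mpoly K[m]} are not
   vectTypes, so the dimension of a subspace is defined here through bases. *)

Section Dimension.
Variables (K : fieldType) (V : lmodType K).
Implicit Types (P : V -> Prop) (r s : nat).

Definition lin_indep r (b : 'I_r -> V) : Prop :=
  forall c : 'I_r -> K, \sum_(i < r) c i *: b i = 0 -> forall i, c i = 0.

Definition spans r (b : 'I_r -> V) P : Prop :=
  forall v, P v <-> exists c : 'I_r -> K, v = \sum_(i < r) c i *: b i.

Definition has_dim P r : Prop :=
  exists b : 'I_r -> V, lin_indep b /\ spans b P.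

(* Meaningful only when P is a finite-dimensional subspace; see dimE. *)
Definition dim P : nat := epsilon (inhabits 0%N) (has_dim P).

Lemma has_dim_leq P r s : has_dim P r -> has_dim P s -> (r <= s)%N.
Proof.
move=> [b [b_free b_span]] [e [_ e_span]].
have Pb i : P (b i).
  apply/b_span; exists (fun j => (j == i)%:R).
  rewrite (bigD1 i) //= eqxx scale1r big1 ?addr0 // => j /negPf ->.
  by rewrite scale0r.
have coords i : {c : 'I_s -> K | b i = \sum_j c j *: e j}.
  by apply: constructive_indefinite_description; apply/e_span.
pose A := \matrix_(i, j) sval (coords i) j : 'M[K]_(r, s).
suff /eqP <- : row_free A by exact: rank_leq_col.
apply/inj_row_free => x xA0; apply/rowP => i; rewrite mxE.
apply: (b_free (fun i => x 0 i)); transitivity (\sum_j (x *m A) 0 j *: e j).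
  rewrite (eq_bigr (fun i => \sum_j (x 0 i * A i j) *: e j)) => [|k _].
    rewrite exchange_big; apply: eq_bigr => j _.
    by rewrite -scaler_suml mxE.
  rewrite {1}(svalP (coords k)) scaler_sumr; apply: eq_bigr => j _.
  by rewrite scalerA mxE.
by rewrite xA0 big1 // => j _; rewrite mxE scale0r.
Qed.

Lemma dimE P r : has_dim P r -> dim P = r.
Proof.
move=> Pr; have Pd : has_dim P (dim P) by apply: epsilon_spec; exists r.
by apply/eqP; rewrite eqn_leq !(has_dim_leq Pr, has_dim_leq Pd).
Qed.

End Dimension.

Definition fps (R : Type) := nat -> R.

Definition fps_deriv (R : pzRingType) (f : fps R) : fps R :=
  fun j => j.+1%:R * f j.+1.

Definition fps_scale (R : pzRingType) (a : R) (f : fps R) : fps R :=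
  fun j => a * f j.

Section Veronese.
Variables (K : fieldType) (m : nat).
Implicit Types (p : {mpoly K[m]}) (M : {mpoly K[m]} -> Prop).

Definition homog_part (j : int) p : Prop :=
  match j with
  | Posz e => p \is e.-homog
  | Negz _ => p = 0
  end.

(* The sum of the S_(l + i d) taken inside S = {mpoly K[m]}; for 0 < d it is
   direct, the degrees l + i d being pairwise distinct. *)
Definition veronese (d : nat) (l : int) p : Prop :=
  exists (N : nat) (s : nat -> {mpoly K[m]}),
    (forall i, homog_part (l + (i * d)%:Z) (s i)) /\ p = \sum_(i < N) s i.

Definition graded_part M (j : int) p : Prop := M p /\ homog_part j p.

(* A graded subspace of S has no nonzero element of negative degree, so only
   the degrees j >= 0 contribute. *)
Definition hilbert_series M : fps int :=
  fun j => (dim (graded_part M j%:Z))%:Z.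

End Veronese.

(* Main.v *)
(** The forms of degree e in m + 1 variables have dimension 'C(e + m, e).  The
    coefficient of z^j on the left involves degree j + 1 = k + i d, the one on
    the right degree j = (k - 1) + i d, so both vanish for the same j, and
    otherwise they agree because (j + 1) 'C(j + n, j + 1) = n 'C(j + n, j). *)

Require Import Defs.
From mathcomp Require Import all_boot all_order all_algebra.
From mathcomp Require Import zify.

Local Open Scope ring_scope.

Import GRing.Theory.

(** [P] and [Q] are only pointwise equivalent, not equal, so the basis is carried over instead of
    rewriting under [dim]. *)
Lemma eq_has_dim_dim (K : fieldType) (V : lmodType K) (P Q : V -> Prop) r :
  (forall v, P v <-> Q v) -> has_dim Q r -> Defs.dim P = r.
Proof.
move=> PQ [b [b_free b_span]]; apply: dimE; exists b; split=> // v.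
by rewrite PQ; exact: b_span.
Qed.

Lemma has_dim0 (K : fieldType) (V : lmodType K) : has_dim (fun v : V => v = 0) 0.
Proof.
exists (fun=> 0); split=> [c _ []//|v]; split=> [->|[c ->]].
  by exists (fun=> 0); rewrite big_ord0.
by rewrite big_ord0.
Qed.

(** The forms of degree [e] make up the [vectType] [dhomog], of known dimension; its basis is sent
    to polynomials by the linear injection [mpoly_of_dhomog]. *)
Lemma has_dim_homog (K : fieldType) m e :
  has_dim (fun p : {mpoly K[m.+1]} => p \is e.-homog) 'C(e + m, e).
Proof.
pose V : vectType K := dhomog m.+1 K e.
have <- : \dim {:V} = 'C(e + m, e) by rewrite dimvf.
pose X := vbasis {:V}.
have Xb : basis_of {:V} X := vbasisP _.
have sumE (c : 'I_(\dim {:V}) -> K) :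
    \sum_i c i *: mpoly_of_dhomog (X`_i : V)
    = mpoly_of_dhomog (\sum_i c i *: X`_i : V).
  by rewrite linear_sum; apply: eq_bigr => i _; rewrite linearZ.
exists (fun i => mpoly_of_dhomog (X`_i : V)); split=> [c|p].
  rewrite sumE => c0; move/freeP: (basis_free Xb); apply.
  by apply: val_inj; rewrite /= c0.
split=> [hp|[c ->]]; last by rewrite sumE; exact: dhomog_is_dhomog.
pose q : V := DHomog hp.
by exists (fun i => coord X i q); rewrite sumE -(coord_basis Xb) ?memvf.
Qed.

Section GradedPart.
Variables (K : fieldType) (m d : nat) (l : int).
Implicit Type p : {mpoly K[m]}.

Lemma homog_part0 j : homog_part j (0 : {mpoly K[m]}).
Proof. by case: j => //= e; exact: dhomog0. Qed.

Lemma homog_part_coeff j p (u : 'X_{1..m}) :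
  homog_part j p -> p@_u != 0 -> j = (mdeg u)%:Z.
Proof.
case: j => [e|e] /= hp; last by rewrite hp mcoeff0 eqxx.
by apply: contra_neq_eq => ue; apply: dhomog_nemf_coeff hp _; rewrite eq_sym.
Qed.

Lemma graded_part_veronese i (e : nat) : l + (i * d)%:Z = e%:Z ->
  forall p, graded_part (veronese d l) e%:Z p <-> p \is e.-homog.
Proof.
move=> lie p; split=> [[]//|hp]; split=> //.
(* The only nonzero summand is [p], at index [i]. *)
exists i.+1, (fun i' => if i' == i then p else 0); split=> [i'|].
  by case: eqP => [->|_]; [rewrite lie | exact: homog_part0].
by rewrite big_ord_recr /= eqxx big1 ?add0r // => j _; rewrite ltn_eqF.
Qed.

Lemma graded_part_veronese0 (e : nat) :
    (forall i, l + (i * d)%:Z <> e%:Z) ->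
  forall p, graded_part (veronese d l) e%:Z p <-> p = 0.
Proof.
move=> nol p; split=> [[[N [s [hs ->]]] hp]|->]; last first.
  split; last exact: homog_part0.
  by exists 0, (fun=> 0); split=> [i|]; rewrite ?big_ord0 //; exact: homog_part0.
(* A monomial [u] of the sum has degree [e], yet it occurs in some summand and so has degree
   [l + i * d]. *)
apply/mpolyP => u; rewrite mcoeff0; apply/eqP/negPn/negP => nz.
have ue := homog_part_coeff _ _ _ hp nz; move/eqP: nz; apply.
rewrite raddf_sum big1 //= => i _; apply/eqP/negPn/negP => nz.
by apply: (nol i); rewrite (homog_part_coeff _ _ _ (hs i) nz) ue.
Qed.

End GradedPart.

Lemma hilbert_series_veronese (K : fieldType) m d l e i :
  l + (i * d)%:Z = e%:Z ->
  hilbert_series (@veronese K m.+1 d l) e = 'C(e + m, e)%:Z.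
Proof.
move=> lie; congr (_%:Z); apply: eq_has_dim_dim (has_dim_homog K m e).
exact: graded_part_veronese lie.
Qed.

Lemma hilbert_series_veronese0 (K : fieldType) m d l e :
  (forall i, l + (i * d)%:Z <> e%:Z) ->
  hilbert_series (@veronese K m d l) e = 0.
Proof.
move=> nol; congr (_%:Z); apply: eq_has_dim_dim (has_dim0 K _).
exact: graded_part_veronese0.
Qed.

Theorem theorem2p1 (K : fieldType) (n d k : nat) (hn : (1 <= n)%N) (hd : (1 <= d)%N) :
  fps_deriv (hilbert_series (@veronese K n d k%:Z)) =1
  fps_scale n%:R (hilbert_series (@veronese K n.+1 d (k%:Z - 1))).
Proof.
case: n hn => // n _ j; rewrite /fps_deriv /fps_scale.
have [/existsP[i /eqP ij]|/existsPn noi] :=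
  (* Bounding [i] makes the search decidable; nothing is lost, as [1 <= d] gives
     [i <= i * d <= j.+1]. *)
  boolP [exists i : 'I_j.+2, k + i * d == j.+1]%N.
  rewrite (hilbert_series_veronese K n d k j.+1 i); last by lia.
  rewrite (hilbert_series_veronese K n.+1 d _ j i); last by lia.
  rewrite !natz -!PoszM; congr Posz.
  (* With N = j + n + 1, this is (j + 1) 'C(N, j + 1) = (N - j) 'C(N, j), where [n.+1] is the
     original [n]. *)
  by rewrite addSnnS mul_bin_left addKn.
have {}noi i : (k + i * d)%N <> j.+1.
  move=> ij; have lt_i : (i < j.+2)%N by nia.
  by have := noi (Ordinal lt_i); rewrite /= ij eqxx.
(* A solution of (k - 1) + i d = j would also solve k + i d = j + 1, so both coefficients vanish. *)
by rewrite !hilbert_series_veronese0 ?mulr0 // => i ij; apply: (noi i); lia.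
Qed.
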